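(* For every integer $k\ge 3$, the $k$-total cut complex of the squared cycle graph $W_{3k+1}$ is homotopy equivalent to the $3$-sphere: $\Delta_k^t(W_{3k+1})\simeq \mathbb{S}^3$.
   Context: The squared cycle graph $W_n$ is the graph with vertex set $[n]=\{1,\dots,n\}$ and edge set $\{\{i,i+1 \bmod n\},\{i,i+2 \bmod n\} : i=1,\dots,n\}$. For a graph $G=(V,E)$ and $k\ge 1$, the $k$-total cut complex $\Delta_k^t(G)$ is the simplicial complex on $V$ whose facets are the complements $V\setminus S$ of independent sets $S$ of $G$ with $|S|=k$; equivalently, $\sigma\subseteq V$ is a face iff $V\setminus\sigma$ contains an independent set of size $k$. *)

(* Defs.v *)
From mathcomp Require Import all_boot all_order all_algebra.
From mathcomp Require Import all_classical all_reals all_analysis.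
Set Implicit Arguments. Unset Strict Implicit. Unset Printing Implicit Defensive.
Import Order.TTheory GRing.Theory Num.Theory.
Import numFieldNormedType.Exports.
Local Open Scope classical_set_scope.
Local Open Scope ring_scope.

(* Squared cycle graph W_n on the vertex set 'I_n = {0,...,n-1}
   (vertex i+1 of the paper is 0-indexed as i): i ~ j iff j = i+1 or i+2 mod n
   (or symmetrically). *)
Definition W_adj (n : nat) (i j : 'I_n) : bool :=
  [|| (j == (i + 1) %% n :> nat)%N, (j == (i + 2) %% n :> nat)%N,
      (i == (j + 1) %% n :> nat)%N | (i == (j + 2) %% n :> nat)%N].

Definition independent (V : finType) (adj : rel V) (S : {set V}) : bool :=
  [forall x in S, forall y in S, ~~ adj x y].

Definition total_cut_face (V : finType) (adj : rel V) (k : nat)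
  (sigma : {set V}) : bool :=
  [exists S : {set V}, [&& independent adj S, #|S| == k & S \subset ~: sigma]].

Definition realization (R : realType) (n : nat) (Delta : pred {set 'I_n})
  : set 'rV[R]_n :=
  [set x : 'rV[R]_n | (forall i, 0 <= x ord0 i) /\ \sum_i x ord0 i = 1
           /\ Delta (finset (fun i => x ord0 i != 0))].

Definition sphere (R : realType) (d : nat) : set 'rV[R]_d.+1 :=
  [set x : 'rV[R]_d.+1 | \sum_i (x ord0 i) ^+ 2 = 1].

Definition homotopic_on (R : realType) (X Y : topologicalType)
  (A : set X) (B : set Y) (f g : X -> Y) : Prop :=
  exists H : R * X -> Y,
    {within [set p | 0 <= p.1 <= 1 /\ A p.2], continuous H} /\
    (forall t x, 0 <= t <= 1 -> A x -> B (H (t, x))) /\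
    (forall x, A x -> H (0, x) = f x /\ H (1, x) = g x).

Definition homotopy_equivalent (R : realType) (X Y : topologicalType)
  (A : set X) (B : set Y) : Prop :=
  exists (f : X -> Y) (g : Y -> X),
    {within A, continuous f} /\ f @` A `<=` B /\
    {within B, continuous g} /\ g @` B `<=` A /\
    homotopic_on R A A (g \o f) id /\ homotopic_on R B B (f \o g) id.

(* Main.v *)
(* Multiplying by the inverse of 3 modulo n = 3k+1 turns the independent k-sets
   of W_n into the cyclic intervals of length k, so a face is a set of vertices
   that misses such an interval. Five vertices can be chosen so that any four of
   them, but not all five, form a face: they span the boundary of a 4-simplex,
   which is a 3-sphere. Every other vertex can be removed without changing the
   homotopy type, because its link is contractible: the vertices of the link
   close to the removed one are dominated by its two nearest neighbours, and
   what is left of the link is a cone over one of the five chosen vertices. *)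
Require Import Defs.
From mathcomp Require Import all_boot all_order all_algebra.
From mathcomp Require Import all_classical all_reals all_analysis.
From mathcomp Require Import zify ring lra.
Import numFieldNormedType.Exports.
Set Implicit Arguments. Unset Strict Implicit. Unset Printing Implicit Defensive.
Import Order.TTheory GRing.Theory Num.Theory.
Local Open Scope classical_set_scope.
Local Open Scope ring_scope.

(** * Deformation retracts *)

Lemma continuous_for_rV (T U : topologicalType) n (f : T -> 'rV[U]_n) (x : T) :
  (forall j, {for x, continuous (fun t => f t ord0 j)}) ->
  {for x, continuous f}.
Proof.
move=> fc A [P nP sPA].
have fP j : nbhs x (fun t => P ord0 j (f t ord0 j)) by exact: (fc j _ (nP ord0 j)).
suff: nbhs x (f @^-1` A) by [].
apply: filterS (filter_forall _ fP) => t tP.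
by apply: sPA => i j; rewrite (ord1 i); exact: tP.
Qed.

Lemma continuous_for_comp_pair (T U V W : topologicalType) (x : T) (f : T -> U)
    (g : T -> V) (H : U * V -> W) :
  {for x, continuous f} -> {for x, continuous g} ->
  {for (f x, g x), continuous H} ->
  {for x, continuous (fun t => H (f t, g t))}.
Proof.
move=> fc gc; apply: (@continuous_comp _ _ _ (fun t => (f t, g t)) H) => A nA.
exact: (cvg_pair fc gc nA).
Qed.

Section continuity_at.
Variables (R : realType) (T : topologicalType) (x : T).

Lemma continuous_for_big (op : R -> R -> R) (x0 : R) I (r : seq I) (P : pred I)
    (F : I -> T -> R) :
  continuous (fun p : R * R => op p.1 p.2) ->
  (forall i, P i -> {for x, continuous (F i)}) ->
  {for x, continuous (fun t => \big[op/x0]_(i <- r | P i) F i t)}.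
Proof. by move=> opc Fc; apply: cvg_big. Qed.

Lemma continuous_for_coord n (f : T -> 'rV[R]_n) j :
  {for x, continuous f} -> {for x, continuous (fun t => f t ord0 j)}.
Proof.
by move=> fc; apply: (@continuous_comp _ _ _ f (fun M : 'rV[R]_n => M ord0 j))
  => //; exact: coord_continuous.
Qed.

End continuity_at.

Section deformation.
Variables (R : realType) (n : nat).
Implicit Types A B C : set 'rV[R]_n.

(* Requiring [H] to be continuous everywhere lets deformations be concatenated
   by adding displacements, without gluing along closed pieces. *)
Definition deformation_retract A B :=
  B `<=` A /\ exists H : R * 'rV[R]_n -> 'rV[R]_n,
    [/\ continuous H,
        forall t x, 0 <= t <= 1 -> A x -> A (H (t, x)),
        forall x, A x -> H (1, x) = x,
        forall x, A x -> B (H (0, x)) &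
        forall x, B x -> H (0, x) = x].

Lemma deformation_retract_refl A : deformation_retract A A.
Proof.
split=> //; exists snd; split=> // p; exact: cvg_snd.
Qed.

Lemma deformation_retract_trans A B C :
  deformation_retract A B -> deformation_retract B C ->
  deformation_retract A C.
Proof.
move=> [BA [H [Hc HA H1 H0 HB]]] [CB [K [Kc KB K1 K0 KC]]].
split; first exact: subset_trans CB BA.
(* Time runs from the retraction at 0 to the identity at 1, so [K] moves during the first half and
   [H] during the second. On points of [A] the idle term equals [H (0, p.2)] and cancels the
   subtracted one. *)
pose L (p : R * 'rV[R]_n) := H (Num.max 0 (2 * p.1 - 1), p.2)
  + K (Num.min 1 (2 * p.1), H (0, p.2)) - H (0, p.2).
have Lhi t x : 2^-1 <= t -> A x -> L (t, x) = H (2 * t - 1, x).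
  move=> t2 Ax; rewrite /L /=.
  have -> : Num.max 0 (2 * t - 1) = 2 * t - 1 by apply/max_idPr; lra.
  have -> : Num.min 1 (2 * t) = 1 by apply/min_idPl; lra.
  by rewrite K1 ?addrK//; exact: H0.
have Llo t x : t <= 2^-1 -> A x -> L (t, x) = K (2 * t, H (0, x)).
  move=> t2 Ax; rewrite /L /=.
  have -> : Num.max 0 (2 * t - 1) = 0 by apply/max_idPl; lra.
  have -> : Num.min 1 (2 * t) = 2 * t by apply/min_idPr; lra.
  by rewrite addrAC subrr add0r.
exists L; split.
- move=> p.
  have c1 : {for p, continuous (fun q : R * 'rV[R]_n => q.1)} by exact: cvg_fst.
  have c2 : {for p, continuous (fun q : R * 'rV[R]_n => q.2)} by exact: cvg_snd.
  have c3 : {for p, continuous (fun q : R * 'rV[R]_n => H (0, q.2))}.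
    by apply: (continuous_for_comp_pair _ c2 (Hc _)); exact: cvg_cst.
  have c4 : {for p, continuous (fun q : R * 'rV[R]_n => 2 * q.1)}.
    by apply: cvgM => //; exact: cvg_cst.
  apply: cvgB => //; apply: cvgD.
  + apply: (continuous_for_comp_pair _ c2 (Hc _)).
    apply: (@continuous_max R _ (fun=> 0) (fun q : R * 'rV[R]_n => 2 * q.1 - 1)).
      exact: cvg_cst.
    by apply: cvgB => //; exact: cvg_cst.
  + apply: (continuous_for_comp_pair _ c3 (Kc _)).
    apply: (@continuous_min R _ (fun=> 1) (fun q : R * 'rV[R]_n => 2 * q.1)) => //.
    exact: cvg_cst.
- move=> t x t01 Ax; have [t2|t2] := leP t 2^-1.
  + by rewrite Llo//; apply/BA/KB; [lra|exact: H0].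
  + by rewrite Lhi ?(ltW t2)//; apply: HA => //; lra.
- move=> x Ax; rewrite Lhi//; last lra.
  by rewrite (_ : 2 * 1 - 1 = 1) ?H1//; lra.
- by move=> x Ax; rewrite Llo// mulr0; apply/K0/H0.
- move=> x Cx; have Bx := CB _ Cx; rewrite Llo// ?mulr0; last exact: BA.
  by rewrite HB// KC.
Qed.

End deformation.

(** * Collapses of simplicial complexes *)

Definition down_closed (V : finType) (D : pred {set V}) :=
  forall s t : {set V}, s \subset t -> D t -> D s.

Section collapse.
Variables (R : realType) (n : nat).
Implicit Types D : pred {set 'I_n}.
Local Notation geom := (@realization R n).

Definition support (x : 'rV[R]_n) : {set 'I_n} := [set i | x ord0 i != 0].

Lemma realization_le1 D x i : geom D x -> x ord0 i <= 1.
Proof.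
move=> [x0 [<- _]]; rewrite (bigD1 i)//= lerDl.
by apply: sumr_ge0 => j _; exact: x0.
Qed.

Lemma eq_realization D D' : D =1 D' -> geom D = geom D'.
Proof. by move=> DD'; congr realization; apply/funext. Qed.

(* When the link of [s] is a cone with apex [w], all faces containing [s] can be
   removed: the mass [min_(i in s) x_i] is moved from each vertex of [s] to [w]. *)
Lemma collapse_retract D D' (s : {set 'I_n}) (w : 'I_n) :
  down_closed D -> s != finset.set0 -> w \notin s ->
  (forall t : {set 'I_n}, s \subset t -> D t -> D (w |: t)) ->
  (forall t, D' t = D t && ~~ (s \subset t)) ->
  deformation_retract (geom D) (geom D').
Proof.
move=> Dd /set0Pn[i0 i0s] ws cone D'E.
(* The default 1 never interferes, because [s] is nonempty and barycentric coordinates are at most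
   1. The entries of [d] sum to 0, so moving along [d] preserves the total mass. *)
pose m (x : 'rV[R]_n) := \big[Num.min/1]_(i in s) x ord0 i.
pose d : 'rV[R]_n := \row_j ((j == w)%:R * #|s|%:R - (j \in s)%:R).
pose H (p : R * 'rV[R]_n) := p.2 + ((1 - p.1) * m p.2) *: d.
have D'D t : D' t -> D t by rewrite D'E => /andP[].
have m_ge0 x : geom D x -> 0 <= m x.
  by move=> [x0 _]; apply/bigmin_geP; split=> // i _; exact: x0.
have m_le x i : i \in s -> m x <= x ord0 i by move=> si; exact: bigmin_le_cond.
have m_eq x : geom D x -> exists2 i, i \in s & m x = x ord0 i.
  move=> Dx; have [i ? ?] := @eq_bigmin _ _ _ 1 i0 (mem s) (fun i => x ord0 i)
    i0s (fun i _ => realization_le1 i Dx).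
  by exists i.
have sumd : \sum_j d ord0 j = 0.
  under eq_bigr do rewrite mxE.
  rewrite sumrB (bigD1 w)//= eqxx mul1r big1 => [|i /negbTE->]; last exact: mul0r.
  rewrite addr0 -sum1_card natr_sum [X in X - _]big_mkcond -sumrB big1// => i _.
  by case: (i \in s); rewrite subrr.
have dw : 0 <= d ord0 w by rewrite mxE eqxx (negbTE ws) subr0 mul1r ler0n.
have ds i : i \in s -> d ord0 i = -1.
  move=> si; rewrite mxE si; have -> : (i == w) = false.
    by apply/negbTE; apply: contraNneq ws => <-.
  by rewrite mul0r sub0r.
have dn i : i != w -> i \notin s -> d ord0 i = 0.
  by move=> /negbTE iw /negbTE si; rewrite mxE iw si mul0r subr0.
have HE t x i : H (t, x) ord0 i = x ord0 i + (1 - t) * m x * d ord0 i.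
  by rewrite /H !mxE.
have H_m0 t x : m x = 0 -> H (t, x) = x.
  by rewrite /H /= => ->; rewrite mulr0 scale0r addr0.
have HA t x : 0 <= t <= 1 -> geom D x -> geom D (H (t, x)).
  move=> t01 Dx; have [x0 [x1 Dsx]] := Dx.
  have tm : 0 <= (1 - t) * m x by rewrite mulr_ge0 ?m_ge0//; lra.
  split.
    move=> i; rewrite HE; have [si|si] := boolP (i \in s).
      rewrite ds// mulrN1 subr_ge0 (le_trans _ (m_le _ _ si))//.
      by rewrite ler_piMl ?m_ge0//; lra.
    have [->|iw] := eqVneq i w; first by rewrite addr_ge0// mulr_ge0.
    by rewrite dn// mulr0 addr0.
  split.
    under eq_bigr do rewrite HE.
    by rewrite big_split /= x1 -mulr_sumr sumd mulr0 addr0.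
  have [m0|m0] := eqVneq (m x) 0; first by rewrite H_m0.
  have sx : s \subset support x.
    apply/fintype.subsetP => i si; rewrite inE; apply: contraNneq m0 => xi.
    by rewrite eq_le m_ge0// andbT -xi m_le.
  (* Only [w] can enter the support, and the cone condition allows this because the support already
     contains [s]. *)
  apply: (Dd _ (w |: support x)); last exact: cone.
  apply/fintype.subsetP => i; rewrite !inE HE; have [//|iw] := eqVneq i w.
  apply: contraNneq => xi; rewrite xi add0r.
  have [si|si] := boolP (i \in s); last by rewrite dn// mulr0.
  by move/fintype.subsetP : sx => /(_ _ si); rewrite inE xi eqxx.
split.
  by move=> x [x0 [x1 /D'D]].
exists H; split.
- move=> p.
  have c1 : {for p, continuous (fun q : R * 'rV[R]_n => q.1)} by exact: cvg_fst.
  have c2 : {for p, continuous (fun q : R * 'rV[R]_n => q.2)} by exact: cvg_snd.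
  have c3 : {for p, continuous (fun q : R * 'rV[R]_n => m q.2)}.
    apply: continuous_for_big; first exact: min_continuous.
    by move=> i _; exact: continuous_for_coord.
  apply: cvgD => //; apply: cvgZr_tmp; apply: cvgM => //.
  by apply: cvgB => //; exact: cvg_cst.
- exact: HA.
- by move=> x _; rewrite /H /= subrr mul0r scale0r addr0.
(* At time 0 a vertex of [s] with the least mass loses all of it, so the support no longer contains
   [s]. *)
- move=> x Dx; have [h0 [h1 hD]] := HA 0 x ltac:(lra) Dx; split=> //; split=> //.
  rewrite D'E hD /=; have [i si mi] := m_eq _ Dx.
  apply/subsetPn; exists i => //.
  by rewrite inE HE subr0 mul1r ds// mulrN1 mi subrr eqxx.
- move=> x [x0 [x1]]; rewrite D'E => /andP[Dx /subsetPn[i si]].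
  rewrite inE negbK => /eqP xi; apply: H_m0; apply/eqP.
  by rewrite eq_le m_ge0 ?andbT -?xi ?m_le.
Qed.

End collapse.

(** * The boundary of a simplex *)

(** The map to [S] is [f] after the retraction [H (0, _)]. Composed with [g] it gives back that
    retraction, so [H] itself is the homotopy on [A], and on [S] a constant homotopy suffices. *)
Lemma retract_homotopy_equivalent (R : realType) n m (A B : set 'rV[R]_n)
    (S : set 'rV[R]_m) (f : 'rV[R]_n -> 'rV[R]_m) (g : 'rV[R]_m -> 'rV[R]_n) :
  deformation_retract A B ->
  (forall x, B x -> {for x, continuous f}) ->
  (forall y, S y -> {for y, continuous g}) ->
  (forall x, B x -> S (f x)) -> (forall y, S y -> B (g y)) ->
  (forall x, B x -> g (f x) = x) -> (forall y, S y -> f (g y) = y) ->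
  homotopy_equivalent R A S.
Proof.
move=> [BA [H [Hc HA H1 H0 HB]]] fc gc fS gB gf fg.
exists (fun x => f (H (0, x))), g; split; [|split; [|split; [|split; [|split]]]].
- apply: continuous_in_subspaceT => x /set_mem Ax.
  apply: (@continuous_comp _ _ _ (fun x => H (0, x)) f); last exact/fc/H0.
  by apply: (continuous_for_comp_pair _ _ (Hc _)); [exact: cst_continuous|move=> ?].
- by move=> _ [x Ax <-]; exact/fS/H0.
- by apply: continuous_in_subspaceT => y /set_mem /gc.
- by move=> _ [y Sy <-]; exact/BA/gB.
- exists H; split; [|split].
  + by apply: continuous_in_subspaceT => p _; exact: Hc.
  + by move=> t x; exact: HA.
  + by move=> x Ax /=; rewrite gf ?H1//; exact: H0.
- exists snd; split; [|split] => //.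
  + by apply: continuous_in_subspaceT => p _; exact: cvg_snd.
  + by move=> y Sy /=; split=> //; rewrite HB ?fg//; exact: gB.
Qed.

Section simplex_boundary.
Variables (R : realType) (n d : nat) (p : 'I_d.+2 -> 'I_n).
Hypothesis p_inj : injective p.
Let P := [set p j | j in [set: 'I_d.+2]]%SET.
Local Notation bd := (@realization R n (fun t => t \proper P)).

(* With [y_0 := 0], these are the inverse homeomorphisms
   [x |-> (x_{p j} - x_{p 0})_{j > 0}], normalised to the sphere, and
   [y |-> (y_j - min_i y_i)_j], normalised to the simplex. *)
Definition bd_diff (x : 'rV[R]_n) (j : 'I_d.+1) :=
  x ord0 (p (lift ord0 j)) - x ord0 (p ord0).
Definition bd_norm x := Num.sqrt (\sum_j bd_diff x j ^+ 2).
Definition to_sphere (x : 'rV[R]_n) : 'rV[R]_d.+1 :=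
  \row_j (bd_diff x j / bd_norm x).

Definition sph_min (y : 'rV[R]_d.+1) := \big[Num.min/0]_j y ord0 j.
Definition sph_pos (y : 'rV[R]_d.+1) (j : 'I_d.+2) :=
  (if unlift ord0 j is Some i then y ord0 i else 0) - sph_min y.
Definition sph_sum y := \sum_j sph_pos y j.
Definition to_boundary (y : 'rV[R]_d.+1) : 'rV[R]_n :=
  \row_i \sum_(j | p j == i) (sph_pos y j / sph_sum y).

Lemma bd_supp x i : bd x -> i \notin P -> x ord0 i = 0.
Proof.
move=> [_ [_ /proper_sub/fintype.subsetP sP]] iP; apply: contraNeq iP => xi.
by apply: sP; rewrite inE.
Qed.

Lemma bd_zero x : bd x -> exists j, x ord0 (p j) = 0.
Proof.
move=> [_ [_ /properP[_ [i /imsetP[j _ ->] xj]]]]; exists j; move: xj.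
by rewrite inE negbK => /eqP.
Qed.

Lemma bd_sum x : bd x -> \sum_j x ord0 (p j) = 1.
Proof.
move=> bx; have [_ [<- _]] := bx.
rewrite [RHS](bigID (mem P))/= [X in _ = _ + X]big1 ?addr0 => [|i].
  by rewrite big_imset /=; [apply: eq_bigl => j; rewrite inE|move=> i j _ _ /p_inj].
exact: bd_supp.
Qed.

(** If all differences vanished, the coordinates at the vertices of [P] would be equal; one of them
    is 0, so their sum could not be 1. *)
Lemma bd_norm_gt0 x : bd x -> 0 < bd_norm x.
Proof.
move=> bx; rewrite sqrtr_gt0 lt_def sumr_ge0 ?andbT => [|j _]; last exact: sqr_ge0.
apply/negP => /eqP /psumr_eq0P /= => /(_ (fun j _ => sqr_ge0 _)) d0.
have E j : x ord0 (p j) = x ord0 (p ord0).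
  have [->//|] := eqVneq j ord0; case: (unliftP ord0 j) => [i -> _|->].
    by apply/eqP; rewrite -subr_eq0 -sqrf_eq0; apply/eqP/d0.
  by rewrite eqxx.
have [j xj] := bd_zero bx.
have := bd_sum bx; under eq_bigr do rewrite E -(E j) xj.
by rewrite big1// => /esym/eqP; rewrite oner_eq0.
Qed.

Lemma to_sphereP x : bd x -> sphere (to_sphere x).
Proof.
move=> bx; have N0 := bd_norm_gt0 bx; rewrite /sphere /=.
under eq_bigr do rewrite mxE expr_div_n.
rewrite -mulr_suml -[X in X / _]sqr_sqrtr -/(bd_norm x).
  by rewrite divff// expf_neq0// gt_eqF.
by apply: sumr_ge0 => j _; exact: sqr_ge0.
Qed.

Lemma sph_pos_ge0 y j : 0 <= sph_pos y j.
Proof.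
rewrite subr_ge0; case: unlift => [i|]; first exact: bigmin_le.
exact: bigmin_le_id.
Qed.

Lemma sph_pos_lift y j : sph_pos y (lift ord0 j) = y ord0 j - sph_min y.
Proof. by rewrite /sph_pos liftK. Qed.

Lemma sph_pos0 y : sph_pos y ord0 = - sph_min y.
Proof. by rewrite /sph_pos unlift_none sub0r. Qed.

(** If every nonnegative term is 0, the one at [ord0] shows that the minimum is 0, and then the
    others force [y] to be 0, which is not on the sphere. *)
Lemma sph_sum_gt0 y : sphere y -> 0 < sph_sum y.
Proof.
rewrite /sphere /= => y1; rewrite lt_def sumr_ge0 ?andbT => [|j _]; last first.
  exact: sph_pos_ge0.
apply/negP => /eqP /psumr_eq0P /= => /(_ (fun j _ => sph_pos_ge0 _ _)) s0.
have m0 : sph_min y = 0 by apply/eqP; rewrite -oppr_eq0 -sph_pos0 s0.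
move: y1; rewrite big1 => [/esym/eqP|j _]; first by rewrite oner_eq0.
by have := s0 (lift ord0 j) isT; rewrite sph_pos_lift m0 subr0 => ->; rewrite expr0n.
Qed.

Lemma to_boundary_p y j : to_boundary y ord0 (p j) = sph_pos y j / sph_sum y.
Proof. by rewrite mxE (big_pred1 j)// => i; rewrite (inj_eq p_inj). Qed.

Lemma sph_pos_zero y : exists j, sph_pos y j = 0.
Proof.
have : sph_min y <= sph_min y by [].
(* Applied to a trivial inequality, [bigmin_leP] tells where the minimum is attained: at the default
   0, which is the coordinate of [ord0], or at some [j]. *)
move=> /bigmin_leP[m0|[j _ mj]].
  by exists ord0; rewrite sph_pos0; apply/eqP; rewrite oppr_eq0 eq_le m0 bigmin_le_id.
exists (lift ord0 j); rewrite sph_pos_lift; apply/eqP.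
by rewrite subr_eq0 eq_le mj bigmin_le.
Qed.

Lemma to_boundaryP y : sphere y -> bd (to_boundary y).
Proof.
move=> Sy; have s0 := sph_sum_gt0 Sy; split; [|split].
- move=> i; rewrite mxE; apply: sumr_ge0 => j _.
  by rewrite divr_ge0 ?sph_pos_ge0// ltW.
- under eq_bigr do rewrite mxE.
  rewrite (exchange_big_dep predT)//=.
  transitivity (\sum_j sph_pos y j / sph_sum y); last first.
    by rewrite -mulr_suml divff// gt_eqF.
  by apply: eq_bigr => j _; rewrite (big_pred1 (p j))// => i; rewrite eq_sym.
- apply/properP; split.
    apply/fintype.subsetP => i; rewrite inE mxE; apply: contraNT => iP.
    rewrite big1// => j /eqP pj; move: iP; rewrite -pj imset_f//.
  have [j j0] := sph_pos_zero y; exists (p j); first exact: imset_f.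
  by rewrite inE to_boundary_p j0 mul0r eqxx.
Qed.

(** The subtracted minimum cancels in the differences, which leaves [y] divided by [sph_sum y];
    normalising undoes the scaling because [y] has norm 1. *)
Lemma to_boundaryK y : sphere y -> to_sphere (to_boundary y) = y.
Proof.
move=> Sy; have s0 := sph_sum_gt0 Sy.
have dE j : bd_diff (to_boundary y) j = y ord0 j / sph_sum y.
  by rewrite /bd_diff !to_boundary_p sph_pos_lift sph_pos0 -mulrBl opprK subrK.
have NE : bd_norm (to_boundary y) = (sph_sum y)^-1.
  rewrite /bd_norm; under eq_bigr do rewrite dE expr_div_n.
  by rewrite -mulr_suml Sy mul1r -exprVn sqrtr_sqr gtr0_norm// invr_gt0.
apply/rowP => j; rewrite mxE dE NE invrK mulfVK// gt_eqF//.
Qed.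

Lemma to_sphereK x : bd x -> to_boundary (to_sphere x) = x.
Proof.
move=> bx; have N0 := bd_norm_gt0 bx; have [x0 _] := bx.
(* The differences are bounded below by minus the coordinate at [p ord0], and this bound is attained
   at a vertex of [P] whose coordinate is 0. *)
have mE : sph_min (to_sphere x) = - (x ord0 (p ord0) / bd_norm x).
  apply/eqP; rewrite eq_le; apply/andP; split.
    have [j xj] := bd_zero bx; case: (unliftP ord0 j) => [i|] ji.
      apply: (bigmin_inf i) => //.
      by rewrite mxE /bd_diff -ji xj sub0r mulNr.
    by rewrite -ji xj mul0r oppr0 bigmin_le_id.
  apply/bigmin_geP; split=> [|i _].
    by rewrite oppr_le0 divr_ge0// ltW.
  by rewrite mxE /bd_diff mulrBl lerBrDr addrC subrr divr_ge0// ltW.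
have pE j : sph_pos (to_sphere x) j = x ord0 (p j) / bd_norm x.
  case: (unliftP ord0 j) => [i|] ->; last by rewrite sph_pos0 mE opprK.
  by rewrite sph_pos_lift mE mxE /bd_diff opprK -mulrDl subrK.
have sE : sph_sum (to_sphere x) = (bd_norm x)^-1.
  by rewrite /sph_sum; under eq_bigr do rewrite pE;
    rewrite -mulr_suml bd_sum// mul1r.
apply/rowP => i; have [/imsetP[j _ ->]|iP] := boolP (i \in P).
  by rewrite to_boundary_p pE sE invrK mulfVK// gt_eqF.
rewrite mxE (bd_supp bx iP) big1// => j /eqP ji.
by move: iP; rewrite -ji imset_f.
Qed.

Lemma to_sphere_continuous x : bd x -> {for x, continuous to_sphere}.
Proof.
move=> bx; apply: continuous_for_rV => j.
have dc i : {for x, continuous (bd_diff ^~ i)}.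
  by apply: (@continuousB _ _ _ (fun t : 'rV[R]_n => t ord0 _)
    (fun t : 'rV[R]_n => t ord0 _)); exact: coord_continuous.
have Nc : {for x, continuous bd_norm}.
  apply: (@continuous_comp _ _ _ (fun x => \sum_j bd_diff x j ^+ 2) Num.sqrt).
    apply: continuous_for_big => [|i _]; first exact: add_continuous.
    by apply: (@continuousM _ _ (bd_diff ^~ i) (bd_diff ^~ i)); exact: dc.
  exact: sqrt_continuous.
rewrite /to_sphere (_ : (fun t => _) = (fun t => bd_diff t j / bd_norm t)).
  apply: (@continuousM _ _ (bd_diff ^~ j) (fun t => (bd_norm t)^-1)) => //.
  by apply: continuousV => //; rewrite gt_eqF// bd_norm_gt0.
by apply/funext => t; rewrite mxE.
Qed.

Lemma to_boundary_continuous y : sphere y -> {for y, continuous to_boundary}.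
Proof.
move=> Sy; apply: continuous_for_rV => i.
have mc : {for y, continuous sph_min}.
  apply: continuous_for_big; first exact: min_continuous.
  by move=> j _; exact: coord_continuous.
have pc j : {for y, continuous (sph_pos ^~ j)}.
  apply: (@continuousB _ _ _ (fun t : 'rV[R]_d.+1 =>
    if unlift ord0 j is Some i then t ord0 i else 0)) => //.
  by case: unlift => [k|]; [exact: coord_continuous|exact: cst_continuous].
have sc : {for y, continuous sph_sum}.
  by apply: continuous_for_big => // ; exact: add_continuous.
rewrite /to_boundary (_ : (fun t => _) =
  (fun t => \sum_(j | p j == i) (sph_pos t j / sph_sum t))).
  apply: continuous_for_big; first exact: add_continuous.
  move=> j _; apply: (@continuousM _ _ (sph_pos ^~ j)
    (fun t => (sph_sum t)^-1)) => //.
  by apply: continuousV => //; rewrite gt_eqF// sph_sum_gt0.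
by apply/funext => t; rewrite mxE.
Qed.

Lemma retract_boundary_sphere (A : set 'rV[R]_n) :
  deformation_retract A bd -> homotopy_equivalent R A (@sphere R d).
Proof.
move=> Abd; apply: (@retract_homotopy_equivalent _ _ _ _ _ _ to_sphere
  to_boundary Abd).
- exact: to_sphere_continuous.
- exact: to_boundary_continuous.
- exact: to_sphereP.
- exact: to_boundaryP.
- exact: to_sphereK.
- exact: to_boundaryK.
Qed.

End simplex_boundary.

(** * Removal of a vertex *)

Section vertex_removal.
Variables (R : realType) (n : nat).
Implicit Types (D : pred {set 'I_n}) (X t : {set 'I_n}).
Local Notation geom := (@realization R n).

(** This deletes the vertices of [B] from the link of [v], and nothing else from [D]. *)
Definition ban D v (B : seq 'I_n) t :=
  D t && ((v \in t) ==> all (fun s => s \notin t) B).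

Lemma ban_down D v B : down_closed D -> down_closed (ban D v B).
Proof.
move=> Dd s t /[dup] st /fintype.subsetP ssub /andP[Dt /implyP tB].
apply/andP; split; first exact: Dd st Dt.
apply/implyP => /ssub /tB /allP tB'; apply/allP => x /tB'.
by apply: contra; exact: ssub.
Qed.

(** The edges from [v] to the vertices of [B] are collapsed one at a time, the link of each being a
    cone with apex [w]. As [w] is not in [B], adding it never violates an earlier ban. *)
Lemma ban_retract D v w (B : seq 'I_n) :
  down_closed D -> w != v -> w \notin B ->
  (forall s t, s \in B -> v \in t -> s \in t -> D t -> D (w |: t)) ->
  deformation_retract (geom D) (geom (ban D v B)).
Proof.
move=> Dd wv; elim: B => [|s B IH].
  move=> _ _; rewrite (@eq_realization _ _ (ban D v [::]) D).
    exact: deformation_retract_refl.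
  by move=> t; rewrite /ban /= implybT andbT.
rewrite inE negb_or => /andP[ws wB] cone.
apply: deformation_retract_trans (IH wB _) _.
  by move=> s' t s'B; apply: cone; rewrite inE s'B orbT.
apply: (@collapse_retract _ _ _ _ [set v; s]%SET w).
- exact: ban_down.
- by apply/set0Pn; exists v; rewrite !inE eqxx.
- by rewrite !inE negb_or wv.
- move=> t; rewrite finset.subUset !finset.sub1set => /andP[vt st].
  move=> /andP[Dt /implyP /(_ vt) tB].
  apply/andP; split; first by apply: cone st Dt; rewrite ?inE ?eqxx.
  apply/implyP => _; apply/allP => x xB; rewrite !inE negb_or (allP tB)// andbT.
  by apply: contraNneq wB => <-.
- move=> t; rewrite /ban finset.subUset !finset.sub1set /=.
  by case: (D t); case: (v \in t); case: (s \in t); rewrite /= ?andbT ?andbF.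
Qed.

(** Here [off] is the position on a cycle of length 3k+1, counted from [v]. The bound on [u] below
    keeps a missed interval within positions 1 to 3k, so that it neither wraps around nor covers
    [v]. *)
Variables (k : nat) (D : pred {set 'I_n}) (v : 'I_n) (off : 'I_n -> nat).
Hypothesis D_down : down_closed D.
Hypothesis off_lt : forall x, (off x < 3 * k + 1)%N.
Hypothesis off_eq0 : forall x, (off x == 0%N) = (x == v).
Hypothesis gap_face : forall u t, (0 < u <= 2 * k + 1)%N ->
  (forall x, x \in t -> ~~ (u <= off x < u + k)%N) -> D t.
Hypothesis face_gap : forall t, v \in t -> D t ->
  exists2 u, (0 < u <= 2 * k + 1)%N &
    forall x, x \in t -> ~~ (u <= off x < u + k)%N.

(* In the link of [v], the vertices at distance at most [k] on either side of
   [v] are dominated by the nearest ones [a] and [b]; once they are gone, [w] is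
   a cone point of what remains. *)
Lemma vertex_removal (X : {set 'I_n}) (a0 w b0 : 'I_n) :
  v \in X -> a0 \in X -> w \in X -> b0 \in X -> a0 != v ->
  (off a0 + k < off w)%N -> (off w + k < off b0)%N ->
  deformation_retract (geom (fun t => D t && (t \subset X)))
    (geom (fun t => D t && (t \subset X :\ v))).
Proof.
move=> vX a0X wX b0X a0v a0w wb0.
have v0 : off v = 0%N by apply/eqP; rewrite off_eq0.
have lt_b0 := off_lt b0.
have Xa0 : (a0 \in X) && (a0 != v) by rewrite a0X.
have [a /andP[aX av] a_min] :=
  @arg_minnP _ a0 (fun x => (x \in X) && (x != v)) off Xa0.
have [b bX b_max] := @arg_maxnP _ b0 (fun x => x \in X) off b0X.
have aa0 : (off a <= off a0)%N by apply: a_min; rewrite a0X.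
have bb0 : (off b0 <= off b)%N by apply: b_max.
have off_gt0 x : x != v -> (0 < off x)%N by rewrite -off_eq0 lt0n.
have a_gt0 := off_gt0 _ av.
have lt_b := off_lt b.
pose DX t := D t && (t \subset X).
have DX_down : down_closed DX.
  move=> s t st /andP[Dt tX]; apply/andP; split; first exact: D_down st Dt.
  exact: fintype.subset_trans st tX.
(* A gap of [k] positions starting at 1 or later cannot end before position [k]. Hence a face
   through [v] and some [s] in [L] has its gap after [s], and [a] can be added to it. [M] and [b]
   are the mirror image. *)
pose L := enum [set s in X | (off a < off s <= k)%N].
pose M := enum [set s in X | (2 * k + 1 <= off s < off b)%N].
have memL x : (x \in L) = (x \in X) && (off a < off x <= k)%N.
  by rewrite mem_enum inE.
have memM x : (x \in M) = (x \in X) && (2 * k + 1 <= off x < off b)%N.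
  by rewrite mem_enum inE.
have addX x t : x \in X -> t \subset X -> x |: t \subset X.
  by move=> xX tX; rewrite finset.subUset finset.sub1set xX.
pose D1 := ban DX v L.
have D1_down : down_closed D1 by exact: ban_down.
pose D2 := ban D1 v M.
have order : [&& off a + k < off w, off w + k < off b & off b <= 3 * k]%N.
  by move: aa0 bb0 a0w wb0 lt_b; clear; lia.
have bv : b != v by rewrite -off_eq0; move: order; clear; lia.
have wv : w != v by rewrite -off_eq0; move: order; clear; lia.
apply: (@deformation_retract_trans _ _ _ (geom D1)).
  apply: (@ban_retract _ _ a) => //.
    by rewrite memL ltnn andbF.
  move=> s t; rewrite memL => /andP[sX sk] vt st /andP[Dt tX].
  apply/andP; split; last exact: addX.
  have [u u1 ut] := face_gap vt Dt; apply: (gap_face u1) => x.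
  rewrite !inE => /orP[/eqP->|]; last exact: ut.
  by move: (ut _ st) u1 sk; clear; lia.
apply: (@deformation_retract_trans _ _ _ (geom D2)).
  apply: (@ban_retract _ _ b) => //.
    by rewrite memM ltnn !andbF.
  move=> s t; rewrite memM => /andP[sX sk] vt st /andP[/andP[Dt tX] /implyP tL].
  apply/andP; split.
    apply/andP; split; last exact: addX.
    have [u u1 ut] := face_gap vt Dt; apply: (gap_face u1) => x.
    rewrite !inE => /orP[/eqP->|]; last exact: ut.
    by move: (ut _ st) u1 sk order; clear; lia.
  apply/implyP => _; apply/allP => x xL; rewrite !inE negb_or.
  rewrite (allP (tL vt))// andbT; apply: contraTneq xL => ->.
  by rewrite memL; move: order; clear; lia.
apply: (@collapse_retract _ _ _ _ [set v]%SET w).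
- exact: ban_down.
- by apply/set0Pn; exists v; rewrite inE.
- by rewrite inE.
- move=> t; rewrite finset.sub1set => vt.
  move=> /andP[/andP[/andP[Dt tX] /implyP/(_ vt)/allP tL] /implyP/(_ vt)/allP tM].
  have wL : w \notin L by rewrite memL; move: order; clear; lia.
  have wM : w \notin M by rewrite memM; move: order; clear; lia.
  have nbans (B : seq 'I_n) : {in B, forall x, x \notin t} -> w \notin B ->
      all (fun s => s \notin w |: t) B.
    move=> tB wB; apply/allP => x xB; rewrite !inE negb_or tB// andbT.
    by apply: contraNneq wB => <-.
  rewrite /D2 /D1 /ban /DX !nbans// addX// !implybT !andbT.
  have {}tX x : x \in t -> x \in X by move/fintype.subsetP: tX; apply.
  have nL x : x \in t -> ~~ (off a < off x <= k)%N.
    by move=> xt; apply: contraL (xt) => xa; apply: tL; rewrite memL tX.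
  have nM x : x \in t -> ~~ (2 * k + 1 <= off x < off b)%N.
    by move=> xt; apply: contraL (xt) => xa; apply: tM; rewrite memM tX.
  have ta x : x \in t -> (off x == 0%N) || (off a <= off x)%N.
    by move=> xt; rewrite off_eq0; case: eqVneq => //= xv; apply: a_min; rewrite tX.
  have tb x : x \in t -> (off x <= off b)%N by move=> xt; apply: b_max; exact: tX.
  have addw u : (0 < u <= 2 * k + 1)%N ->
      (forall x, x \in t -> ~~ (u <= off x < u + k)%N) ->
      ~~ (u <= off w < u + k)%N -> D (w |: t).
    move=> u1 ut uw; apply: (gap_face u1) => x.
    by rewrite !inE => /orP[/eqP->|/ut].
  (* The next four cases look for a gap of [t] that avoids [w]: positions 1 to [k] if [a] is missed,
     the last [k] positions if [b] is missed, then the [k] positions just after [a] or just before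
     [b]. *)
  have [/exists_inP[xa xat /eqP xaE]|/exists_inPn na] :=
      boolP [exists x in t, off x == off a]; last first.
    apply: (addw 1%N); [by clear; lia| |by move: order; clear; lia].
    by move=> x xt; move: (na _ xt) (nL _ xt) (ta _ xt); clear; lia.
  have [/exists_inP[xb xbt /eqP xbE]|/exists_inPn nb] :=
      boolP [exists x in t, off x == off b]; last first.
    apply: (addw (2 * k + 1)%N); [by clear; lia| |by move: order; clear; lia].
    by move=> x xt; move: (nb _ xt) (nM _ xt) (tb _ xt); clear; lia.
  have [/exists_inP[x1 x1t x1E]|/exists_inPn n1] :=
      boolP [exists x in t, (off a < off x <= off a + k)%N]; last first.
    apply: (addw (off a + 1)%N); [by move: order; clear; lia| |
      by move: order; clear; lia].
    by move=> x xt; move: (n1 _ xt); clear; lia.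
  have [/exists_inP[x2 x2t x2E]|/exists_inPn n2] :=
      boolP [exists x in t, (off b - k <= off x < off b)%N]; last first.
    apply: (addw (off b - k)%N); [by move: order; clear; lia| |
      by move: order; clear; lia].
    by move=> x xt; move: (n2 _ xt) order; clear; lia.
  (* Now [x1] and [x2] lie on either side of [w], and the bans on [L] and [M] place them at
     positions above [k] and at most [2 * k]. Fewer than [k] positions separate them, so the gap of
     [t] cannot contain [w]. *)
  have [u u1 ut] := face_gap vt Dt; apply: (addw u) => //.
  move: (ut _ x1t) (ut _ x2t) (nL _ x1t) (nM _ x2t) u1 x1E x2E order.
  by clear; lia.
- move=> t; rewrite finset.sub1set /D2 /D1 /ban /DX finset.subsetD1.
  by case: (v \in t); rewrite /= ?andbT ?andbF.
Qed.

End vertex_removal.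

(** * The squared cycle graph *)

Section squared_cycle.
Variable k : nat.
Hypothesis k_ge3 : (3 <= k)%N.
Let n := (3 * k + 1)%N.
Let n_gt0 : (0 < n)%N. Proof. by rewrite /n addn1. Qed.
Let face := total_cut_face (@W_adj n) k.

Definition shift (c : nat) (x : 'I_n) : 'I_n := Ordinal (ltn_pmod (x + c) n_gt0).

(* Multiplication by [2 k + 1], the inverse of 3 modulo [n], turns the steps of
   length 3 of an independent set into steps of length 1; note that
   [k = - (2 k + 1)] modulo [n]. *)
Definition offset (v x : 'I_n) : nat := (((2 * k + 1) * x + k * v) %% n)%N.
Definition at_offset (v : 'I_n) q : 'I_n := shift (3 * q) v.

Lemma offset_lt v x : (offset v x < n)%N.
Proof. exact: ltn_pmod. Qed.

Lemma offset_shift c v x :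
  offset v (shift c x) = ((offset v x + (2 * k + 1) * c) %% n)%N.
Proof.
rewrite /offset /= modnDml -modnDml modnMmr modnDml.
by congr (_ %% _)%N; ring.
Qed.

Lemma offset_refl v : offset v v = 0%N.
Proof.
by rewrite /offset -mulnDl (_ : (2 * k + 1 + k = n)%N) ?modnMr// /n; ring.
Qed.

Lemma offset_at v q : offset v (at_offset v q) = (q %% n)%N.
Proof.
rewrite offset_shift offset_refl add0n.
by rewrite (_ : ((2 * k + 1) * (3 * q) = 2 * q * n + q)%N) ?modnMDl// /n; ring.
Qed.

Lemma offset_inj v : injective (offset v).
Proof.
move=> x y xy; apply/val_inj => /=.
(* Multiplying by 3 undoes the factor [2 * k + 1], since 3(2k+1) = 2n+1. *)
have E z : ((3 * offset v z) %% n = (z + 3 * k * v) %% n)%N.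
  rewrite modnMmr (_ : (3 * ((2 * k + 1) * z + k * v) =
    2 * z * n + (z + 3 * k * v))%N) ?modnMDl// /n; ring.
have /eqP : ((x + 3 * k * v) %% n = (y + 3 * k * v) %% n)%N by rewrite -!E xy.
by rewrite eqn_modDr !modn_small// => /eqP.
Qed.

Lemma modn_caseD a b : (a < n -> b < n ->
  (a + b) %% n = a + b \/ n + (a + b) %% n = a + b)%N.
Proof.
move=> an bn; have [ab|ab] := ltnP (a + b) n; first by left; rewrite modn_small.
by right; rewrite -{1}(subnK ab) modnDr modn_small; lia.
Qed.

(** Changing the base vertex rotates the offsets. The reduction modulo [n] is split into two linear
    cases so that [lia] can use it. *)
Lemma offset_cocycle u v x : offset u x = offset v x + offset u v :> nat \/
  (n + offset u x = offset v x + offset u v)%N.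
Proof.
have -> : offset u x = ((offset v x + offset u v) %% n)%N.
  rewrite /offset modnDm (_ : ((2 * k + 1) * x + k * v +
    ((2 * k + 1) * v + k * u) = v * n + ((2 * k + 1) * x + k * u))%N).
    by rewrite modnMDl.
  by rewrite /n; ring.
by apply: modn_caseD; exact: offset_lt.
Qed.

Lemma adj_shift (x y : 'I_n) : W_adj x y =
  [|| y == shift 1 x, y == shift 2 x, x == shift 1 y | x == shift 2 y].
Proof. by []. Qed.

Lemma shift_inj c : injective (shift c).
Proof.
move=> x y /(congr1 val) /= /eqP; rewrite eqn_modDr !modn_small// => /eqP.
exact: val_inj.
Qed.

Lemma shiftD b c x : shift b (shift c x) = shift (c + b) x.
Proof. by apply/val_inj; rewrite /= modnDml addnA. Qed.

Lemma independentP (S : {set 'I_n}) :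
  reflect (forall x y, x \in S -> y \in S -> ~~ W_adj x y)
    (independent (@W_adj n) S).
Proof.
apply: (iffP forall_inP) => [h x y xS yS|h x xS].
  by have /forall_inP := h x xS; exact.
by apply/forall_inP => y yS; exact: h.
Qed.

(** The [k] vertices at consecutive offsets are independent: shifts by 1 and 2 change the offset by
    2k+1 and k+1 modulo [n], that is by -k and -2k, so they leave any interval of [k] offsets. *)
Lemma gap_face v u (t : {set 'I_n}) : (0 < u <= 2 * k + 1)%N ->
  (forall x, x \in t -> ~~ (u <= offset v x < u + k)%N) -> face t.
Proof.
move=> u1 ut; pose f (j : 'I_k) := at_offset v (u + j).
have fE j : offset v (f j) = (u + j)%N.
  by rewrite offset_at modn_small// /n; have := ltn_ord j; lia.
have f_inj : injective f.
  by move=> i j /(congr1 (offset v)); rewrite !fE => /addnI/val_inj.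
apply/existsP; exists [set f j | j in [set: 'I_k]]%SET; apply/and3P; split.
- have nadj c i j : (c == 1%N) || (c == 2%N) -> f i != shift c (f j).
    move=> c12; apply: contraTneq (c12) => /(congr1 (offset v)).
    rewrite offset_shift !fE => ij.
    have jk := ltn_ord j; have ik := ltn_ord i.
    have ujn : (u + j < n)%N by rewrite /n; move: u1 jk; clear; lia.
    have ck a : (u + i = (u + j + a) %% n)%N -> (a < n)%N ->
      (u + i = u + j + a \/ n + (u + i) = u + j + a)%N.
      by move=> -> an; exact: modn_caseD.
    move: ij; case/orP: c12 => /eqP ->.
      rewrite muln1 => /(ck (2 * k + 1)%N); rewrite /n.
      by move: jk ik k_ge3; clear; lia.
    have -> : ((u + j + (2 * k + 1) * 2) %% n = (u + j + (k + 1)) %% n)%N.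
      by rewrite -[RHS]modnDr; congr (_ %% _)%N; rewrite /n; ring.
    by move=> /(ck (k + 1)%N); rewrite /n; move: jk ik k_ge3; clear; lia.
  apply/independentP => _ _ /imsetP[i _ ->] /imsetP[j _ ->].
  by rewrite adj_shift !negb_or !nadj.
- by rewrite card_imset// cardsT card_ord.
- apply/fintype.subsetP => _ /imsetP[j _ ->]; rewrite inE.
  by apply/negP => /ut; rewrite fE; have := ltn_ord j; lia.
Qed.

(** * Independent sets of size k as cyclic intervals *)

Section independent_sets.
Variables (S : {set 'I_n}) (v : 'I_n).
Hypothesis S_indep : independent (@W_adj n) S.
Hypothesis S_card : #|S| = k.
Hypothesis vS : v \notin S.

Lemma indep_shift c x : (c == 1%N) || (c == 2%N) -> x \in S -> shift c x \notin S.
Proof.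
move=> c12 xS; apply/negP => yS; have /independentP/(_ _ _ xS yS) := S_indep.
by rewrite adj_shift; case/orP: c12 => /eqP->; rewrite eqxx ?orbT.
Qed.

(* [S], [S + 1] and [S + 2] are disjoint, hence miss only one vertex. *)
Lemma indep_step_uniq x y : x \in S -> y \in S ->
  shift 3 x \notin S -> shift 3 y \notin S -> x = y.
Proof.
move=> xS yS x3 y3; apply/eqP/negPn/negP => xy.
pose f (p : 'I_n * 'I_3) := shift p.2 p.1.
pose U := f @: finset.setX S [set: 'I_3].
have cU : #|U| = (k * 3)%N.
  rewrite card_in_imset; first by rewrite cardsX S_card cardsT card_ord.
  move=> [a i] [b j]; rewrite !inE !andbT /f /= => aS bS.
  wlog ij : a b i j aS bS / (i <= j)%N.
    by move=> W; case: (leqP i j) => [/W|/ltnW/W h /esym/h ->//]; exact.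
  rewrite -(subnK ij) -shiftD => /shift_inj ab.
  have : (j - i < 3)%N by rewrite (leq_ltn_trans (leq_subr _ _)).
  case E : (j - i)%N ab => [|[|[|//]]] ab _.
  - rewrite (_ : i = j); last first.
      by apply/val_inj; move: ij E => /=; clear; lia.
    congr (_, _); rewrite ab; apply/val_inj => /=.
    by rewrite addn0 modn_small.
  - by have := indep_shift (c := 1) isT bS; rewrite -ab aS.
  - by have := indep_shift (c := 2) isT bS; rewrite -ab aS.
(* If [shift 3 z] were a shift by 1 or 2 of some [a] in [S], then [a] would be [shift 2 z] or
   [shift 1 z], a neighbour of [z]. *)
have nU z : z \in S -> shift 3 z \notin S -> shift 3 z \notin U.
  move=> zS z3; apply/negP => /imsetP[[a i]]; rewrite !inE andbT /f /= => aS.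
  case: i => [[|[|[|//]]] i] /= za.
  - by move: z3; rewrite za (_ : shift 0 a = a) ?aS//;
      apply/val_inj; rewrite /= addn0 modn_small.
  - have := indep_shift (c := 2) isT zS.
    by rewrite (_ : shift 2 z = a) ?aS//; apply: (@shift_inj 1); rewrite shiftD.
  - have := indep_shift (c := 1) isT zS.
    by rewrite (_ : shift 1 z = a) ?aS//; apply: (@shift_inj 2); rewrite shiftD.
(* Two distinct vertices outside [U] would make 3k+2 vertices in all. *)
have : (#|[set shift 3 x; shift 3 y]%SET :|: U| <= n)%N.
  by rewrite -[X in (_ <= X)%N]card_ord max_card.
rewrite cardsU (_ : _ :&: U = finset.set0) ?cards0 ?cU; last first.
  apply/finset.setP => z; rewrite !inE; apply/negP => /andP[/orP[] /eqP-> ].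
    by apply/negP; exact: nU.
  by apply/negP; exact: nU.
by rewrite cards2 (inj_eq (@shift_inj 3)) xy /n; lia.
Qed.

Lemma card_offset_le (lo hi : nat) :
  (forall x, x \in S -> (lo < offset v x <= hi)%N) -> (k <= hi - lo)%N.
Proof.
move=> h; rewrite -S_card cardE -(size_map (offset v)) -(size_iota lo.+1 (hi - lo)).
apply: uniq_leq_size; first by rewrite map_inj_uniq ?enum_uniq//; exact: offset_inj.
move=> q /mapP[x]; rewrite mem_enum => /h xE ->.
by rewrite mem_iota; lia.
Qed.

(** Adding 3 to a vertex raises its offset by 1. The element [m] of [S] with the largest offset has
    no successor in [S], and by [indep_step_uniq] it is the only such element. So [S] is a single
    run of [k] offsets ending at [m]. *)
Lemma indep_gap : exists2 u, (0 < u <= 2 * k + 1)%N &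
  forall x, (u <= offset v x < u + k)%N -> x \in S.
Proof.
have off_gt0 x : x \in S -> (0 < offset v x)%N.
  move=> xS; rewrite lt0n -(offset_refl v) (inj_eq (@offset_inj v)).
  by apply: contraNneq vS => <-.
have [x0 x0S] : exists x, x \in S.
  by apply/set0Pn; rewrite -card_gt0 S_card; lia.
have [m mS m_max'] := @arg_maxnP _ x0 (fun x => x \in S) (offset v) x0S.
have {m_max'}m_max x : x \in S -> (offset v x <= offset v m)%N by exact: m_max'.
have off3 x : offset v (shift 3 x) = ((offset v x + 1) %% n)%N.
  rewrite offset_shift (_ : ((2 * k + 1) * 3 = 2 * n + 1)%N) ?/n; last by ring.
  by rewrite addnCA modnMDl.
have m3 : shift 3 m \notin S.
  apply/negP => m3; have := m_max _ m3; have := off_gt0 _ m3; rewrite off3.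
  have := offset_lt v m; rewrite leq_eqVlt => /orP[/eqP mn|mn].
    by rewrite addn1 mn modnn.
  by rewrite modn_small ?addn1//; lia.
have km : (k <= offset v m)%N.
  rewrite -[X in (_ <= X)%N]subn0; apply: card_offset_le => x xS.
  by rewrite off_gt0//=; exact: m_max.
have mn := offset_lt v m.
exists (offset v m - k + 1)%N; first by move: mn km; rewrite /n; lia.
have up j x : x \in S -> (offset v x + j <= offset v m)%N ->
    at_offset v (offset v x + j) \in S.
  elim: j => [|j IH] xS xj.
    rewrite addn0 (_ : at_offset _ _ = x)//; apply: (@offset_inj v).
    by rewrite offset_at modn_small// offset_lt.
  have /IH yS : (offset v x + j <= offset v m)%N by lia.
  set y := at_offset _ _ in yS; have yE : offset v y = (offset v x + j)%N.
    by rewrite offset_at modn_small//; lia.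
  rewrite (_ : at_offset _ _ = shift 3 y).
    apply/negPn/negP => y3; have := indep_step_uniq (yS xS) mS y3 m3.
    by move=> /(congr1 (offset v)); rewrite yE; move: xj; clear; lia.
  by apply: (@offset_inj v); rewrite off3 offset_at yE addnS addn1.
(* If [z] were missing, no element of [S] could lie below it, since its run up to [m] would pass
   through [z]. Fewer than [k] offsets would then remain for [S]. *)
move=> z zE; apply/negPn/negP => zS.
have : (k <= offset v m - offset v z)%N.
  apply: card_offset_le => x xS; rewrite (m_max _ xS) andbT ltnNge.
  apply/negP => xz; have := up (offset v z - offset v x)%N x xS.
  rewrite subnKC//; move: zE xz => /= zE xz.
  have -> : at_offset v (offset v z) = z.
    by apply: (@offset_inj v); rewrite offset_at modn_small// offset_lt.
  by move=> /(_ ltac:(lia)); apply/negP.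
by lia.
Qed.

End independent_sets.

Lemma face_gap v (t : {set 'I_n}) : v \in t -> face t ->
  exists2 u, (0 < u <= 2 * k + 1)%N &
    forall x, x \in t -> ~~ (u <= offset v x < u + k)%N.
Proof.
move=> vt /existsP[S /and3P[Si /eqP Sk /fintype.subsetP St]].
have vS : v \notin S by apply/negP => /St; rewrite inE vt.
have [u u1 uS] := indep_gap Si Sk vS; exists u => // x xt.
by apply/negP => /uS /St; rewrite inE xt.
Qed.

Lemma face_down : down_closed face.
Proof.
move=> s t st /existsP[S /and3P[Si Sk St]]; apply/existsP; exists S.
by rewrite Si Sk /= (fintype.subset_trans St)// finset.setCS.
Qed.

(* Any four of these five offsets leave a cyclic gap of at least [k] vertices,
   while no such gap is left by all five. *)
Definition corners := [:: 0; 2; k + 1; k + 3; 2 * k + 2]%N.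
Let o : 'I_n := Ordinal n_gt0.
Definition corner (j : 'I_5) : 'I_n := at_offset o (nth 0%N corners j).
Let P := [set corner j | j in [set: 'I_5]]%SET.

Lemma corners_lt q : q \in corners -> (q < n)%N.
Proof. by rewrite !inE /n; move: k_ge3; clear; lia. Qed.

Lemma offset_corner j : offset o (corner j) = nth 0%N corners j.
Proof. by rewrite offset_at modn_small// corners_lt// mem_nth/=. Qed.

Lemma corner_inj : injective corner.
Proof.
move=> i j /(congr1 (offset o)); rewrite !offset_corner => /eqP.
rewrite nth_uniq//; first by move=> /eqP /val_inj.
by rewrite /= !inE; move: k_ge3; clear; lia.
Qed.

Lemma mem_corner x : (x \in P) = (offset o x \in corners).
Proof.
apply/imsetP/idP => [[j _ ->]|xc]; first by rewrite offset_corner mem_nth.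
have xs : (index (offset o x) corners < 5)%N by rewrite -index_mem in xc.
exists (Ordinal xs) => //; apply: (@offset_inj o).
by rewrite offset_corner nth_index.
Qed.

Lemma mem_at_offset q : q \in corners -> at_offset o q \in P.
Proof.
by move=> qc; rewrite mem_corner offset_at modn_small// corners_lt.
Qed.

(** * Reduction to the five corners *)

Lemma remove_noncorner (R : realType) (X : {set 'I_n}) v :
  P \subset X -> v \in X -> v \notin P ->
  deformation_retract (@realization R n (fun t => face t && (t \subset X)))
    (@realization R n (fun t => face t && (t \subset X :\ v))).
Proof.
move=> /fintype.subsetP PX vX vP.
have vn := offset_lt o v; have v_co := vP; rewrite mem_corner in v_co.
(* The numbers [a], [w], [b] are the offsets of three corners as seen from [v], with the reduction
   modulo [n] spelled out. *)
have cut qa qw qb : qa \in corners -> qw \in corners -> qb \in corners ->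
    (exists a w b, [/\ a + offset o v = qa \/ a + offset o v = n + qa,
      w + offset o v = qw \/ w + offset o v = n + qw,
      b + offset o v = qb \/ b + offset o v = n + qb &
      [/\ a < n, w < n, b < n, a + k < w & w + k < b]])%N ->
  deformation_retract (@realization R n (fun t => face t && (t \subset X)))
    (@realization R n (fun t => face t && (t \subset X :\ v))).
  move=> qac qwc qbc [a [w [b [aE wE bE [an wn bn aw wb]]]]].
  have offE q c : q \in corners -> (c < n)%N ->
      (c + offset o v = q \/ c + offset o v = n + q)%N ->
      offset v (at_offset o q) = c.
    move=> qc cn; have := offset_cocycle o v (at_offset o q).
    rewrite offset_at modn_small ?corners_lt//.
    have := offset_lt v (at_offset o q); have := corners_lt qc.
    by move: cn vn; rewrite /n; clear; lia.
  apply: (@vertex_removal R n k face v (offset v) face_down _ _ _ _ X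
    (at_offset o qa) (at_offset o qw) (at_offset o qb)) => //.
  - by move=> x; exact: offset_lt.
  - by move=> x; rewrite -(offset_refl v) (inj_eq (@offset_inj v)).
  - by move=> u t; exact: gap_face.
  - by move=> t; exact: face_gap.
  - exact/PX/mem_at_offset.
  - exact/PX/mem_at_offset.
  - exact/PX/mem_at_offset.
  - by apply: contraNneq vP => <-; exact: mem_at_offset.
  - by rewrite (offE _ _ qac an aE) (offE _ _ qwc wn wE).
  - by rewrite (offE _ _ qbc bn bE) (offE _ _ qwc wn wE).
set Q := offset o v in cut vn v_co *.
move: v_co; rewrite !inE !negb_or => /and5P[Q0 Q2 Q3 Q4 Q5].
(* There is one case for each arc between consecutive corners. The corner after [v] is [qa], the one
   before it is [qb], and [qw] lies two corners from both. Corners two apart are at distance k+1 or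
   2k-2, which exceeds [k] as k is at least 3. *)
have [Q1|Q1] := ltnP Q 2.
  apply: (cut 2 (k + 3) 0)%N; rewrite ?inE ?eqxx ?orbT//.
  exists (2 - Q)%N, (k + 3 - Q)%N, (n - Q)%N.
  by split; [lia|lia|lia|rewrite /n; split; lia].
have [Q6|Q6] := ltnP Q (k + 1).
  apply: (cut (k + 1) (2 * k + 2) 2)%N; rewrite ?inE ?eqxx ?orbT//.
  exists (k + 1 - Q)%N, (2 * k + 2 - Q)%N, (n + 2 - Q)%N.
  by split; [lia|lia|lia|rewrite /n; split; lia].
have [Q7|Q7] := ltnP Q (k + 3).
  apply: (cut (k + 3) 0 (k + 1))%N; rewrite ?inE ?eqxx ?orbT//.
  exists (k + 3 - Q)%N, (n - Q)%N, (n + (k + 1) - Q)%N.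
  by split; [lia|lia|lia|rewrite /n; split; lia].
have [Q8|Q8] := ltnP Q (2 * k + 2).
  apply: (cut (2 * k + 2) 2 (k + 3))%N; rewrite ?inE ?eqxx ?orbT//.
  exists (2 * k + 2 - Q)%N, (n + 2 - Q)%N, (n + (k + 3) - Q)%N.
  by split; [lia|lia|lia|rewrite /n; split; lia].
apply: (cut 0 (k + 1) (2 * k + 2))%N; rewrite ?inE ?eqxx ?orbT//.
exists (n - Q)%N, (n + (k + 1) - Q)%N, (n + (2 * k + 2) - Q)%N.
by split; [lia|lia|lia|rewrite /n; split; lia].
Qed.

Lemma remove_noncorners (R : realType) (l : seq 'I_n) :
  uniq l -> {in l, forall x, x \notin P} ->
  deformation_retract (@realization R n face)
    (@realization R n (fun t => face t && (t \subset ~: [set x in l]))).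
Proof.
elim: l => [|v l IH] /=.
  move=> _ _; rewrite (_ : (fun t => _) = face).
    exact: deformation_retract_refl.
  apply/funext => t; rewrite (_ : (t \subset _) = true) ?andbT//.
  by apply/fintype.subsetP => x _; rewrite !inE.
move=> /andP[vl ul] lP.
have lP' : {in l, forall x, x \notin P}.
  by move=> x xl; apply: lP; rewrite inE xl orbT.
apply: deformation_retract_trans (IH ul lP') _.
have -> : ~: [set x in v :: l]%SET = ~: [set x in l]%SET :\ v.
  by apply/finset.setP => x; rewrite !inE negb_or.
apply: remove_noncorner.
- by apply/fintype.subsetP => x xP; rewrite !inE; apply: contraL xP; exact: lP'.
- by rewrite !inE.
- by apply: lP; rewrite inE eqxx.
Qed.

(** At most k-2 positions lie strictly between consecutive corners, so [P] leaves no gap of length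
    [k]. Dropping a corner merges two arcs into one of length at least k+1, which does contain such
    a gap. *)
Lemma face_corners (t : {set 'I_n}) : t \subset P -> face t = (t != P).
Proof.
move=> tP; have [->|tnP] := eqVneq t P.
  apply/negbTE/negP => /(@face_gap o) []; first by rewrite mem_corner offset_refl.
  move=> u u1 uP.
  have gapP q : q \in corners -> ~~ (u <= q < u + k)%N.
    move=> qc; have := uP _ (mem_at_offset qc).
    by rewrite offset_at modn_small// corners_lt.
  have := gapP 2%N; have := gapP (k + 1)%N; have := gapP (k + 3)%N.
  have := gapP (2 * k + 2)%N; rewrite !inE !eqxx !orbT.
  by move=> /(_ isT) + /(_ isT) + /(_ isT) + /(_ isT); lia.
suff: face t by move->.
have /properP[_ [m mP mt]] : t \proper P by rewrite finset.properEneq tnP.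
have co x : x \in t -> offset o x \in corners /\ offset o x != offset o m.
  move=> xt; rewrite -mem_corner (fintype.subsetP tP)//; split=> //.
  by rewrite (inj_eq (@offset_inj o)); apply: contraNneq mt => <-.
(* The gap consists of the [k] positions following [q], possibly wrapping past 0; seen from the
   corner at [q], it starts at offset 1. *)
have cut q : q \in corners -> (forall x, x \in t ->
    (offset o x = q \/ q + k < offset o x \/
     offset o x < q /\ q + k < n + offset o x)%N) -> face t.
  move=> qc qt; apply: (@gap_face (at_offset o q) 1) => [|x xt]; first lia.
  have := qt _ xt; have := offset_cocycle o (at_offset o q) x.
  rewrite offset_at modn_small ?corners_lt//.
  have := offset_lt o x; have := offset_lt (at_offset o q) x.
  by rewrite /n; clear; lia.
rewrite mem_corner in mP; move: mP co; set M := offset o m; clearbody M.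
move=> mP co; have {}co x : x \in t ->
    [&& offset o x \in corners & offset o x != M].
  by move=> /co [-> ->].
have go q : q \in corners -> (forall z, z \in corners -> z != M ->
    [|| z == q, q + k < z | (z < q) && (q + k < n + z)]%N) -> face t.
  move=> qc h; apply: (cut q qc) => x /co /andP[xc xM].
  by have := h _ xc xM; lia.
(* In each case [q] is the corner just before the missing one in cyclic order. *)
move: mP; rewrite !inE => /or4P[/eqP ME|/eqP ME|/eqP ME|/orP[]/eqP ME].
- apply: (go (2 * k + 2)%N); first by rewrite !inE eqxx !orbT.
  by move=> z; rewrite ME !inE /n; move: k_ge3; clear; lia.
- apply: (go 0%N); first by rewrite !inE eqxx.
  by move=> z; rewrite ME !inE /n; move: k_ge3; clear; lia.
- apply: (go 2%N); first by rewrite !inE eqxx !orbT.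
  by move=> z; rewrite ME !inE /n; move: k_ge3; clear; lia.
- apply: (go (k + 1)%N); first by rewrite !inE eqxx !orbT.
  by move=> z; rewrite ME !inE /n; move: k_ge3; clear; lia.
- apply: (go (k + 3)%N); first by rewrite !inE eqxx !orbT.
  by move=> z; rewrite ME !inE /n; move: k_ge3; clear; lia.
Qed.

Lemma squared_cycle_sphere (R : realType) :
  homotopy_equivalent R (@realization R n face) (@sphere R 3).
Proof.
apply: (@retract_boundary_sphere R n 3 corner corner_inj).
have lP : {in enum (~: P), forall x, x \notin P}.
  by move=> x; rewrite mem_enum inE.
have := remove_noncorners R (enum_uniq _) lP.
congr (deformation_retract _ (realization _)).
apply/funext => t; rewrite (_ : ~: [set x in enum (~: P)] = P).
  transitivity (t \proper P) => //; rewrite finset.properEneq.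
  have [tP|_] := boolP (t \subset P); last by rewrite !andbF.
  by rewrite !andbT face_corners.
by apply/finset.setP => x; rewrite !inE mem_enum inE negbK.
Qed.

End squared_cycle.

Theorem theorem4p2 (R : realType) (k : nat) (hk : (3 <= k)%N) :
  homotopy_equivalent R
    (@realization R _ (total_cut_face (@W_adj (3 * k + 1)) k))
    (@sphere R 3).
Proof. exact: squared_cycle_sphere. Qed.
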